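(* Let $P$ be the set of odd primes and, for each $Q\subseteq P$, let $$\mathcal W_Q=\mathsf V\bigl(S_7,\{S_{\mathbf c_q}:q\in Q\}\bigr).$$ The map $Q\mapsto\mathcal W_Q$ is an order embedding of the power set $\mathcal P(P)$ (ordered by inclusion) into the interval $[\mathsf V(S_7),\mathsf V(M_2(S_7))]$ of the lattice of ai-semiring varieties.
   Context: An additively idempotent semiring (ai-semiring) is an algebra $(S,+,\cdot)$ with $(S,+)$ a commutative idempotent semigroup, $(S,\cdot)$ a semigroup, and multiplication distributing over addition on both sides. $\mathsf V(\cdot)$ denotes the variety generated by the listed ai-semirings; varieties are ordered by inclusion, and $[\mathcal U,\mathcal W]$ is the set of varieties $\mathcal V$ with $\mathcal U\subseteq\mathcal V\subseteq\mathcal W$. $S_7=\{1,a,\infty\}$ is the ai-semiring with addition $x+x=x$ and $x+y=\infty$ for $x\ne y$, and with commutative multiplication $1\cdot 1=1$, $1\cdot a=a\cdot 1=a$, $a\cdot a=\infty$, $x\cdot\infty=\infty\cdot x=\infty$. $M_2(S_7)$ is the ai-semiring of all $2\times2$ matrices over $S_7$ with entrywise addition and usual matrix multiplication. For $q\ge3$, $S_{\mathbf c_q}$ is the graph semiring of the directed $q$-cycle $a_1\to a_2\to\cdots\to a_q\to a_1$: its underlying set is $\{a_1,\dots,a_q\}\,\dot\cup\,\{0,\omega\}$; $x+x=x$ and the sum of two distinct elements is $0$; for vertices $u,v$, $uv=\omega$ if $u\to v$ is an edge of the cycle and $uv=0$ otherwise; every product involving $0$ or $\omega$ is $0$. *)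

(* Defs.v *)
From HB Require Import structures.
From mathcomp Require Import all_boot matrix.
From mathcomp Require Import boolp classical_sets.

Set Implicit Arguments.
Unset Strict Implicit.
Unset Printing Implicit Defensive.

Local Open Scope classical_set_scope.

Declare Scope ais_scope.
Delimit Scope ais_scope with AIS.

(* The library's [semigroupType] and [addSemigroupType] carry a [choiceType]
   structure; here the carrier is an arbitrary nonempty type. *)
HB.mixin Record isAISemiring S := {
  ais_add : S -> S -> S;
  ais_mul : S -> S -> S;
  ais_inhabited : inhabited S;
  ais_addA : associative ais_add;
  ais_addC : commutative ais_add;
  ais_addxx : idempotent_op ais_add;
  ais_mulA : associative ais_mul;
  ais_mulDl : left_distributive ais_mul ais_add;
  ais_mulDr : right_distributive ais_mul ais_add
}.

#[short(type="aiSemiringType")]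
HB.structure Definition AISemiring := {S of isAISemiring S}.

Notation "x + y" := (ais_add x y) : ais_scope.
Notation "x * y" := (ais_mul x y) : ais_scope.

Definition ais_hom (A B : aiSemiringType) (f : A -> B) : Prop :=
  {morph f : x y / (x + y)%AIS} /\ {morph f : x y / (x * y)%AIS}.

Section DirectProduct.
Variables (I : Type) (F : I -> aiSemiringType).

Definition ais_prod : Type := forall i, F i.

Definition ais_prod_add (f g : ais_prod) : ais_prod := fun i => (f i + g i)%AIS.
Definition ais_prod_mul (f g : ais_prod) : ais_prod := fun i => (f i * g i)%AIS.

Fact ais_prod_inhabited : inhabited ais_prod.
Proof.
have inhF i : exists _ : F i, True by have [x] := @ais_inhabited (F i); exists x.
by constructor=> i; have [x _] := cid (inhF i).
Qed.

Fact ais_prod_addA : associative ais_prod_add.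
Proof. by move=> f g h; apply: functional_extensionality_dep => i; apply: ais_addA. Qed.
Fact ais_prod_addC : commutative ais_prod_add.
Proof. by move=> f g; apply: functional_extensionality_dep => i; apply: ais_addC. Qed.
Fact ais_prod_addxx : idempotent_op ais_prod_add.
Proof. by move=> f; apply: functional_extensionality_dep => i; apply: ais_addxx. Qed.
Fact ais_prod_mulA : associative ais_prod_mul.
Proof. by move=> f g h; apply: functional_extensionality_dep => i; apply: ais_mulA. Qed.
Fact ais_prod_mulDl : left_distributive ais_prod_mul ais_prod_add.
Proof. by move=> f g h; apply: functional_extensionality_dep => i; apply: ais_mulDl. Qed.
Fact ais_prod_mulDr : right_distributive ais_prod_mul ais_prod_add.
Proof. by move=> f g h; apply: functional_extensionality_dep => i; apply: ais_mulDr. Qed.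

HB.instance Definition _ := isAISemiring.Build ais_prod
  ais_prod_inhabited ais_prod_addA ais_prod_addC ais_prod_addxx ais_prod_mulA ais_prod_mulDl ais_prod_mulDr.

End DirectProduct.

(* Plain predicates rather than [set aiSemiringType]: the latter would put the
   universe of carriers strictly below that of ['M[S]_2]. *)
Definition ais_class := aiSemiringType -> Prop.

Definition class_incl (U V : ais_class) : Prop := forall A, U A -> V A.

Definition closed_homimage (V : ais_class) : Prop :=
  forall (A B : aiSemiringType) (f : A -> B),
    ais_hom f -> (forall y, exists x, f x = y) -> V A -> V B.

(* Subalgebras are presented, up to isomorphism, by injective homomorphisms. *)
Definition closed_subalgebra (V : ais_class) : Prop :=
  forall (A B : aiSemiringType) (f : A -> B),
    ais_hom f -> injective f -> V B -> V A.

Definition closed_product (V : ais_class) : Prop :=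
  forall (I : Type) (F : I -> aiSemiringType),
    (forall i, V (F i)) -> V (ais_prod F).

Definition is_variety (V : ais_class) : Prop :=
  [/\ closed_homimage V, closed_subalgebra V & closed_product V].

Definition generated_variety (K : ais_class) : ais_class :=
  fun A => forall V, is_variety V -> class_incl K V -> V A.

Definition in_interval (U W V : ais_class) : Prop :=
  [/\ is_variety V, class_incl U V & class_incl V W].

Inductive S7 := S7_1 | S7_a | S7_inf.

Definition S7_add (x y : S7) : S7 :=
  match x, y with
  | S7_1, S7_1 => S7_1
  | S7_a, S7_a => S7_a
  | _, _ => S7_inf
  end.

Definition S7_mul (x y : S7) : S7 :=
  match x, y with
  | S7_1, S7_1 => S7_1
  | S7_1, S7_a | S7_a, S7_1 => S7_a
  | _, _ => S7_inf
  end.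

Fact S7_inhabited : inhabited S7. Proof. exact: inhabits S7_1. Qed.
Fact S7_addA : associative S7_add. Proof. by do 3!case. Qed.
Fact S7_addC : commutative S7_add. Proof. by do 2!case. Qed.
Fact S7_addxx : idempotent_op S7_add. Proof. by case. Qed.
Fact S7_mulA : associative S7_mul. Proof. by do 3!case. Qed.
Fact S7_mulDl : left_distributive S7_mul S7_add. Proof. by do 3!case. Qed.
Fact S7_mulDr : right_distributive S7_mul S7_add. Proof. by do 3!case. Qed.

HB.instance Definition _ := isAISemiring.Build S7 S7_inhabited
  S7_addA S7_addC S7_addxx S7_mulA S7_mulDl S7_mulDr.

Definition mx2 (S : Type) : Type := 'M[S]_2.

Section Matrices.
Variable S : aiSemiringType.

Definition mx2_add (A B : mx2 S) : mx2 S := (\matrix_(i, j) (A i j + B i j)%AIS)%R.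

(* There is no zero in S, hence no [mulmx]: the sum over the two values of the
   middle index is written out. *)
Definition mx2_mul (A B : mx2 S) : mx2 S :=
  (\matrix_(i, j) (A i ord0 * B ord0 j + A i ord_max * B ord_max j)%AIS)%R.

Fact mx2_inhabited : inhabited (mx2 S).
Proof. by have [x] := @ais_inhabited S; constructor; exact: const_mx x. Qed.

Fact ais_addACA (x y z t : S) : ((x + y) + (z + t) = (x + z) + (y + t))%AIS.
Proof.
by rewrite -!ais_addA; congr (_ + _)%AIS; rewrite !ais_addA (ais_addC y).
Qed.

Fact mx2_addA : associative mx2_add.
Proof. by move=> A B C; apply/matrixP=> i j; rewrite !mxE ais_addA. Qed.
Fact mx2_addC : commutative mx2_add.
Proof. by move=> A B; apply/matrixP=> i j; rewrite !mxE ais_addC. Qed.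
Fact mx2_addxx : idempotent_op mx2_add.
Proof. by move=> A; apply/matrixP=> i j; rewrite !mxE ais_addxx. Qed.
Fact mx2_mulA : associative mx2_mul.
Proof.
move=> A B C; apply/matrixP=> i j; rewrite !mxE.
by rewrite !ais_mulDl !ais_mulDr !ais_mulA ais_addACA.
Qed.
Fact mx2_mulDl : left_distributive mx2_mul mx2_add.
Proof.
by move=> A B C; apply/matrixP=> i j; rewrite !mxE !ais_mulDl ais_addACA.
Qed.
Fact mx2_mulDr : right_distributive mx2_mul mx2_add.
Proof.
by move=> A B C; apply/matrixP=> i j; rewrite !mxE !ais_mulDr ais_addACA.
Qed.

HB.instance Definition _ := isAISemiring.Build (mx2 S)
  mx2_inhabited mx2_addA mx2_addC mx2_addxx mx2_mulA mx2_mulDl mx2_mulDr.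

End Matrices.

Inductive cycle_semiring (q : nat) :=
  cyc_vertex of 'I_q | cyc_zero | cyc_omega.
Arguments cyc_zero {q}.
Arguments cyc_omega {q}.

Section CycleSemiring.
Variable q : nat.
Local Notation T := (cycle_semiring q).

Definition cyc_add (x y : T) : T :=
  match x, y with
  | cyc_vertex u, cyc_vertex v => if u == v then cyc_vertex u else cyc_zero
  | cyc_omega, cyc_omega => cyc_omega
  | _, _ => cyc_zero
  end.

(* [ordS u] is the cyclic successor of u in {0, ..., q-1}. *)
Definition cyc_mul (x y : T) : T :=
  match x, y with
  | cyc_vertex u, cyc_vertex v => if v == ordS u then cyc_omega else cyc_zero
  | _, _ => cyc_zero
  end.

Fact cyc_inhabited : inhabited T. Proof. exact: inhabits cyc_zero. Qed.
Fact cyc_addA : associative cyc_add.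
Proof.
move=> [u||] [v||] [w||] //=; try by case: ifP.
case: (eqVneq v w) => [evw|nvw] /=; case: (eqVneq u v) => [->|nuv] //=.
- by rewrite evw eqxx.
- by rewrite (negPf nvw).
Qed.
Fact cyc_addC : commutative cyc_add.
Proof. by move=> [u||] [v||] //=; rewrite eq_sym; case: eqP => // ->. Qed.
Fact cyc_addxx : idempotent_op cyc_add.
Proof. by move=> [u||] //=; rewrite eqxx. Qed.
Fact cyc_mulA : associative cyc_mul.
Proof. by move=> [u||] [v||] [w||] //=; repeat case: ifP. Qed.
Fact cyc_mulDl : left_distributive cyc_mul cyc_add.
Proof.
move=> [u||] [v||] [w||] //=; try (by repeat case: ifP).
case: (eqVneq u v) => [<-|nuv] /=; first by case: ifP.
case: (eqVneq w (ordS u)) => [->|_]; case: eqVneq => //.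
by move=> /ordS_inj e; rewrite e eqxx in nuv.
Qed.
Fact cyc_mulDr : right_distributive cyc_mul cyc_add.
Proof.
move=> [u||] [v||] [w||] //=; try (by repeat case: ifP).
case: (eqVneq v w) => [<-|nvw] /=; first by case: ifP.
case: (eqVneq v (ordS u)) => [ev|_]; case: (eqVneq w (ordS u)) => // ew.
by rewrite ev ew eqxx in nvw.
Qed.

HB.instance Definition _ := isAISemiring.Build T
  cyc_inhabited cyc_addA cyc_addC cyc_addxx cyc_mulA cyc_mulDl cyc_mulDr.

End CycleSemiring.

Definition odd_primes : set nat := [set p | prime p /\ odd p].

Definition V_S7 : ais_class :=
  generated_variety (fun A => A = (S7 : aiSemiringType)).

Definition V_M2S7 : ais_class :=
  generated_variety (fun A => A = (mx2 S7 : aiSemiringType)).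

Definition W_ (Q : set nat) : ais_class :=
  generated_variety (fun A => A = (S7 : aiSemiringType) \/
    exists2 q, Q q & A = (cycle_semiring q : aiSemiringType)).

(* Main.v *)
Require Import Defs.
From HB Require Import structures.
From mathcomp Require Import all_boot matrix.
From mathcomp Require Import boolp classical_sets.

(** Membership of the cycle semirings in V(M2(S7)).  In S7 a sum is different
    from the top element [S7_inf] only when all its summands agree, and a
    product of two elements is [S7_a] exactly when one factor is [S7_1] and the
    other [S7_a].  Hence a matrix entry x z + y t can detect the two
    coincidences z = flip x and t = flip y.  Sending the vertex i, in the
    coordinate k, to the matrix with rows (chi (i = k), chi (i <> k + 1)) and
    (inf, chi (i = k + 2)), where chi is [S7_a] on true and [S7_1] on false,
    makes the upper right entry of the product of the matrices of i and j
    constantly [S7_a] when j = i + 1, and [S7_inf] in the coordinate i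
    otherwise; the other entries are all [S7_inf].  So, in a finite power of
    M2(S7), the vertex matrices multiply like the vertices of the cycle, up to
    an ideal [junk] that is collapsed to the zero of the cycle semiring
    ([cycle_in_V_M2S7]).  The semiring S7 itself is the subalgebra of constant
    matrices.

    Separation.  Let t be the sum of the products x_i x_(i+1) around a cycle of
    length p, and consider the identity t t = t ([cycle_identity]).
    - In S7, with p odd, t cannot be [S7_a], since its variables would have to
      alternate between [S7_1] and [S7_a] around an odd cycle
      ([S7_cycle_identity]); the two other elements are idempotent.
    - In the cycle semiring of length q, t is omega exactly when the variables
      form a closed walk of length p in the directed q-cycle, so when q does
      not divide p it is always zero, an idempotent
      ([cycle_cycle_identity]).
    - In the cycle semiring of length p, the obvious closed walk gives t = omega,
      while omega omega is zero ([cycle_not_cycle_identity]).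
    The identities for distinct odd primes p thus tell from W_Q which primes
    belong to Q. *)

Set Implicit Arguments.
Unset Strict Implicit.
Unset Printing Implicit Defensive.

Local Open Scope classical_set_scope.

(** * Generated varieties *)

Lemma generated_variety_is_variety (K : ais_class) :
  is_variety (generated_variety K).
Proof.
split.
- move=> A B f fh fs GA V vV KV; have [hV _ _] := vV.
  by apply: hV fh fs _; apply: GA.
- move=> A B f fh fi GB V vV KV; have [_ sV _] := vV.
  by apply: sV fh fi _; apply: GB.
- move=> I F GF V vV KV; have [_ _ pV] := vV.
  by apply: pV => i; apply: GF.
Qed.

Lemma generated_variety_base (K : ais_class) : class_incl K (generated_variety K).
Proof. by move=> A KA V _; apply. Qed.

Lemma generated_variety_min (K V : ais_class) :
  is_variety V -> class_incl K V -> class_incl (generated_variety K) V.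
Proof. by move=> vV KV A; apply. Qed.

Section RelationalDivision.
Variables (P A : aiSemiringType) (R : P -> A -> Prop).
Hypothesis R_add : forall x y a b, R x a -> R y b -> R (x + y)%AIS (a + b)%AIS.
Hypothesis R_mul : forall x y a b, R x a -> R y b -> R (x * y)%AIS (a * b)%AIS.
Hypothesis R_fun : forall x a b, R x a -> R x b -> a = b.
Hypothesis R_onto : forall a, exists x, R x a.

Definition rel_domain : Type := {x : P | exists a, R x a}.

Let addD (x y : rel_domain) : rel_domain.
Proof.
exists (sval x + sval y)%AIS.
by case: x y => [x [a Ra]] [y [b Rb]]; exists (a + b)%AIS; apply: R_add.
Defined.

Let mulD (x y : rel_domain) : rel_domain.
Proof.
exists (sval x * sval y)%AIS.
by case: x y => [x [a Ra]] [y [b Rb]]; exists (a * b)%AIS; apply: R_mul.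
Defined.

Let rel_domain_inhabited : inhabited rel_domain.
Proof.
by have [a] := @ais_inhabited A; have [x Rx] := R_onto a; constructor; exists x, a.
Qed.

Let eqD (x y : rel_domain) : sval x = sval y -> x = y.
Proof. by case: x y => [x Px] [y Py] /= exy; apply: eq_exist. Qed.

Let addDA : associative addD.
Proof. by move=> x y z; apply: eqD; apply: ais_addA. Qed.
Let addDC : commutative addD.
Proof. by move=> x y; apply: eqD; apply: ais_addC. Qed.
Let addDxx : idempotent_op addD.
Proof. by move=> x; apply: eqD; apply: ais_addxx. Qed.
Let mulDA : associative mulD.
Proof. by move=> x y z; apply: eqD; apply: ais_mulA. Qed.
Let mulDDl : left_distributive mulD addD.
Proof. by move=> x y z; apply: eqD; apply: ais_mulDl. Qed.
Let mulDDr : right_distributive mulD addD.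
Proof. by move=> x y z; apply: eqD; apply: ais_mulDr. Qed.

HB.instance Definition _ := isAISemiring.Build rel_domain rel_domain_inhabited
  addDA addDC addDxx mulDA mulDDl mulDDr.

(** The domain of R is a subalgebra of P, and R, being functional, is a
    surjective homomorphism from it onto A.  Working with a relation avoids
    describing the subalgebra and its congruence separately. *)
Lemma variety_division (V : ais_class) : is_variety V -> V P -> V A.
Proof.
move=> [homV subV _] VP.
pose f (x : rel_domain) : A := sval (cid (svalP x)).
have fP x : R (sval x) (f x) by rewrite /f; case: (cid _).
apply: (homV (rel_domain : aiSemiringType) A f).
- by split=> x y; apply: R_fun (fP _) _; [apply: R_add | apply: R_mul]; apply: fP.
- move=> a; have [x Rx] := R_onto a.
  pose x' : rel_domain := exist _ x (ex_intro _ a Rx).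
  by exists x'; apply: (R_fun (fP x') Rx).
- exact: (subV _ P (fun x : rel_domain => sval x) _ eqD VP).
Qed.

End RelationalDivision.

(** * S7 and the cycle semirings in the variety of M2(S7) *)

Lemma const_mx_hom (S : aiSemiringType) :
  ais_hom (fun x : S => const_mx x : mx2 S).
Proof.
by split=> x y; apply/matrixP => i j; rewrite !mxE // ais_addxx.
Qed.

(** Addition being idempotent, the product of two constant matrices is the
    constant matrix of the product. *)
Lemma S7_in_V_M2S7 : V_M2S7 S7.
Proof.
have [_ subV _] := generated_variety_is_variety
  (fun A => A = (mx2 S7 : aiSemiringType)).
apply: (subV _ (mx2 S7 : aiSemiringType) _ (const_mx_hom S7)).
- by move=> x y /matrixP /(_ ord0 ord0); rewrite !mxE.
- exact: generated_variety_base.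
Qed.

Section CycleInPower.
Variable q : nat.
Hypothesis q_gt0 : 0 < q.

Definition M2S7_power : aiSemiringType := ais_prod (fun _ : 'I_q => mx2 S7).

Definition mx2_of (x y z t : S7) : mx2 S7 :=
  (\matrix_(i, j) if i == ord0 then (if j == ord0 then x else y)
                  else (if j == ord0 then z else t))%R.

Local Notation e11 M := ((M : mx2 S7) ord0 ord0).
Local Notation e12 M := ((M : mx2 S7) ord0 ord_max).
Local Notation e21 M := ((M : mx2 S7) ord_max ord0).
Local Notation e22 M := ((M : mx2 S7) ord_max ord_max).

Lemma mx2P (M N : mx2 S7) :
  e11 M = e11 N -> e12 M = e12 N -> e21 M = e21 N -> e22 M = e22 N -> M = N.
Proof.
move=> h11 h12 h21 h22; apply/matrixP => i j.
have ord2 (k : 'I_2) : k = ord0 \/ k = ord_max.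
  by case: k => [[|[|//]] hk]; [left | right]; apply: val_inj.
by case: (ord2 i) => ->; case: (ord2 j) => ->.
Qed.

Definition chi (b : bool) : S7 := if b then S7_a else S7_1.

(** The entries are chosen so that entry (1,2) of the product of the matrices
    of i and j is chi (i = k) chi (j <> k + 1) + chi (i <> k + 1) chi (j = k + 2):
    for j = i + 1 both summands have exactly one factor [S7_a].  The [S7_inf] in
    position (2,1) makes every other entry of a product infinite, so that
    triple products vanish. *)
Definition vertex_elt (i : 'I_q) : M2S7_power := fun k =>
  mx2_of (chi (i == k)) (chi (i != ordS k)) S7_inf (chi (i == ordS (ordS k))).

Definition omega_elt : M2S7_power := fun=> mx2_of S7_inf S7_a S7_inf S7_inf.

(** An infinite diagonal entry in some coordinate makes the corresponding
    one-sided products infinite at (1,2) there, whatever the other factor: hence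
    both are required.  The condition at (1,2) separates junk from [omega_elt],
    and is inherited by sums because [S7_a] is a sum in only one way. *)
Definition junk (x : M2S7_power) : Prop :=
  [/\ forall k, e21 (x k) = S7_inf, exists k, e11 (x k) = S7_inf,
      exists k, e22 (x k) = S7_inf & exists k, e12 (x k) <> S7_a].

Definition cycle_rel (x : M2S7_power) (a : cycle_semiring q) : Prop :=
  match a with
  | cyc_vertex i => x = vertex_elt i
  | cyc_omega => x = omega_elt
  | cyc_zero => junk x
  end.

Lemma e_add (x y : M2S7_power) k i j :
  ((x + y)%AIS k : mx2 S7) i j = S7_add ((x k : mx2 S7) i j) ((y k : mx2 S7) i j).
Proof. by rewrite mxE. Qed.

Lemma e_mul (x y : M2S7_power) k i j :
  ((x * y)%AIS k : mx2 S7) i j =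
  S7_add (S7_mul ((x k : mx2 S7) i ord0) ((y k : mx2 S7) ord0 j))
         (S7_mul ((x k : mx2 S7) i ord_max) ((y k : mx2 S7) ord_max j)).
Proof. by rewrite mxE. Qed.

Lemma S7_addf x : S7_add x S7_inf = S7_inf. Proof. by case: x. Qed.
Lemma S7_mulf x : S7_mul x S7_inf = S7_inf. Proof. by case: x. Qed.

Lemma cycle_rel_e21 x a k : cycle_rel x a -> e21 (x k) = S7_inf.
Proof. by case: a => [i||] /=; [move=> -> | case | move=> ->]; rewrite ?mxE. Qed.

Lemma mul_e11 (x y : M2S7_power) b k : cycle_rel y b ->
  e11 ((x * y)%AIS k) = S7_inf.
Proof. by move=> /cycle_rel_e21 Ry; rewrite e_mul Ry S7_mulf S7_addf. Qed.

Lemma mul_e21 (x y : M2S7_power) b k : cycle_rel y b ->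
  e21 ((x * y)%AIS k) = S7_inf.
Proof. by move=> /cycle_rel_e21 Ry; rewrite e_mul Ry S7_mulf S7_addf. Qed.

Lemma mul_e22 (x y : M2S7_power) a k : cycle_rel x a ->
  e22 ((x * y)%AIS k) = S7_inf.
Proof. by move=> /cycle_rel_e21 Rx; rewrite e_mul Rx. Qed.

Lemma junk_mul x y a b : cycle_rel x a -> cycle_rel y b ->
  (exists k, e12 ((x * y)%AIS k) <> S7_a) -> junk (x * y)%AIS.
Proof.
move=> Rx Ry; split=> // [k||].
- exact: mul_e21 Ry.
- by exists (Ordinal q_gt0); apply: mul_e11 Ry.
- by exists (Ordinal q_gt0); apply: mul_e22 Rx.
Qed.

Lemma junk_add x y b : junk x -> cycle_rel y b -> junk (x + y)%AIS.
Proof.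
case=> x21 [k11 x11] [k22 x22] [k12 x12] Ry; split.
- by move=> k; rewrite e_add x21.
- by exists k11; rewrite e_add x11.
- by exists k22; rewrite e_add x22.
- by exists k12; rewrite e_add; case: (e12 (x k12)) x12 => //; case: (e12 _).
Qed.

(** Each of the three finite entries of the matrix of i takes in one coordinate
    (i, i - 1 or i - 2) a value that it takes for no other vertex, so the sum is
    infinite there. *)
Lemma vertex_add (i j : 'I_q) : i != j -> junk (vertex_elt i + vertex_elt j)%AIS.
Proof.
move=> /negPf nij; have nji : j == i = false by rewrite eq_sym.
split.
- by move=> k; rewrite e_add !mxE.
- by exists i; rewrite e_add !mxE /= eqxx nji.
- by exists (ord_pred (ord_pred i)); rewrite e_add !mxE /= !ord_predK eqxx nji.
- by exists (ord_pred i); rewrite e_add !mxE /= !ord_predK eqxx nji.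
Qed.

Lemma vertex_add_omega i : junk (vertex_elt i + omega_elt)%AIS.
Proof.
split.
- by move=> k; rewrite e_add !mxE.
- by exists i; rewrite e_add !mxE S7_addf.
- by exists i; rewrite e_add !mxE S7_addf.
- by exists (ord_pred i); rewrite e_add !mxE /= ord_predK eqxx.
Qed.

Lemma cycle_rel_add x y a b : cycle_rel x a -> cycle_rel y b ->
  cycle_rel (x + y)%AIS (a + b)%AIS.
Proof.
have zero_add b' x' y' : cycle_rel x' b' -> junk y' -> junk (x' + y')%AIS.
  by move=> Rx' Jy'; rewrite ais_addC; apply: junk_add Jy' Rx'.
case: a => [i||] Rx; case: b => [j||] Ry.
- rewrite /ais_add /=; case: eqVneq => [eij|nij] /=.
  + by rewrite Rx Ry eij; apply: ais_addxx.
  + by rewrite Rx Ry; apply: vertex_add.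
- exact: (zero_add (cyc_vertex i)) Rx Ry.
- by rewrite /= Rx Ry; apply: vertex_add_omega.
- exact: (@junk_add _ _ (cyc_vertex j)) Rx Ry.
- exact: (@junk_add _ _ cyc_zero) Rx Ry.
- exact: (@junk_add _ _ cyc_omega) Rx Ry.
- by rewrite /= Rx Ry ais_addC; apply: vertex_add_omega.
- exact: (zero_add cyc_omega) Rx Ry.
- by rewrite /= Rx Ry; apply: ais_addxx.
Qed.

Lemma mul_e12_left (x y : M2S7_power) k : e11 (x k) = S7_inf -> e12 ((x * y)%AIS k) <> S7_a.
Proof. by move=> x11; rewrite e_mul x11. Qed.

Lemma mul_e12_right (x y : M2S7_power) k : e22 (y k) = S7_inf -> e12 ((x * y)%AIS k) <> S7_a.
Proof. by move=> y22; rewrite e_mul y22 S7_mulf S7_addf. Qed.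

Lemma vertex_mul_next i :
  (vertex_elt i * vertex_elt (ordS i))%AIS = omega_elt.
Proof.
apply: functional_extensionality_dep => k.
have Ri : cycle_rel (vertex_elt i) (cyc_vertex i) by [].
have Rj : cycle_rel (vertex_elt (ordS i)) (cyc_vertex (ordS i)) by [].
apply: mx2P; rewrite ?(mul_e11 _ _ Rj) ?(mul_e21 _ _ Rj) ?(mul_e22 _ _ Ri).
- by rewrite mxE.
- rewrite e_mul !mxE /= !(inj_eq (@ordS_inj _)).
  by case: (i == k); case: (i == ordS k).
- by rewrite mxE.
- by rewrite mxE.
Qed.

(** In the coordinate i, entry (1,1) of the matrix of i is [S7_a], and so is
    entry (1,2) of the matrix of j, as j <> i + 1; the product of [S7_a] with
    itself is infinite. *)
Lemma vertex_mul_other i j : j != ordS i ->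
  junk (vertex_elt i * vertex_elt j)%AIS.
Proof.
move=> nij; apply: (@junk_mul _ _ (cyc_vertex i) (cyc_vertex j)) => //.
by exists i; rewrite e_mul !mxE /= eqxx nij.
Qed.

Lemma cycle_rel_inf x a : (forall i, a <> cyc_vertex i) -> cycle_rel x a ->
  (exists k, e11 (x k) = S7_inf) /\ (exists k, e22 (x k) = S7_inf).
Proof.
case: a => [i /(_ i)||] // _; first by case.
by move=> ->; split; exists (Ordinal q_gt0); rewrite mxE.
Qed.

Lemma cycle_rel_mul x y a b : cycle_rel x a -> cycle_rel y b ->
  cycle_rel (x * y)%AIS (a * b)%AIS.
Proof.
move=> Rx Ry.
have junk_left : (forall i, a <> cyc_vertex i) -> junk (x * y)%AIS.
  move=> /cycle_rel_inf /(_ Rx) [[k xk] _].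
  by apply: junk_mul Rx Ry _; exists k; apply: mul_e12_left.
have junk_right : (forall j, b <> cyc_vertex j) -> junk (x * y)%AIS.
  move=> /cycle_rel_inf /(_ Ry) [_ [k yk]].
  by apply: junk_mul Rx Ry _; exists k; apply: mul_e12_right.
case: a Rx junk_left => [i||] Rx junk_left; try exact: junk_left.
case: b Ry junk_right => [j||] Ry junk_right; try exact: junk_right.
rewrite /ais_mul /= Rx Ry; case: eqVneq => [->|nij] /=.
- exact: vertex_mul_next.
- exact: vertex_mul_other.
Qed.

Lemma vertex_not_junk i : ~ junk (vertex_elt i).
Proof. by case=> _ [k]; rewrite mxE /=; case: (i == k). Qed.

Lemma omega_not_junk : ~ junk omega_elt.
Proof. by case=> _ _ _ [k]; rewrite mxE. Qed.

Lemma vertex_neq_omega i : vertex_elt i <> omega_elt.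
Proof.
by move=> /(congr1 (fun x : M2S7_power => e11 (x i))); rewrite !mxE /= eqxx.
Qed.

Lemma vertex_elt_inj : injective vertex_elt.
Proof.
move=> i j /(congr1 (fun x : M2S7_power => e11 (x i))).
by rewrite !mxE /= eqxx; case: eqP.
Qed.

Lemma cycle_rel_fun x a b : cycle_rel x a -> cycle_rel x b -> a = b.
Proof.
case: a => [i||] Rx; case: b => [j||] //= Ry.
- by congr cyc_vertex; apply: vertex_elt_inj; rewrite -Rx.
- by rewrite Rx in Ry; case: (vertex_not_junk Ry).
- by rewrite Rx in Ry; case: (vertex_neq_omega Ry).
- by rewrite Ry in Rx; case: (vertex_not_junk Rx).
- by rewrite Ry in Rx; case: (omega_not_junk Rx).
- by rewrite Rx in Ry; case: (@vertex_neq_omega j).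
- by rewrite Rx in Ry; case: (omega_not_junk Ry).
Qed.

Lemma cycle_rel_onto a : exists x, cycle_rel x a.
Proof.
case: a => [i||]; [by exists (vertex_elt i) | | by exists omega_elt].
by exists (fun=> const_mx S7_inf); split=> [k|||]; try exists (Ordinal q_gt0);
  rewrite mxE.
Qed.

Lemma cycle_in_V_M2S7 : V_M2S7 (cycle_semiring q).
Proof.
have vV := generated_variety_is_variety (fun A => A = (mx2 S7 : aiSemiringType)).
apply: (variety_division cycle_rel_add cycle_rel_mul cycle_rel_fun cycle_rel_onto vV).
by have [_ _ pV] := vV; apply: pV => k; apply: generated_variety_base.
Qed.

End CycleInPower.

(** * The identity attached to a closed walk *)

Section NonemptySums.
Variable A : aiSemiringType.

(** There is no neutral element for addition, so the sum has n + 1 terms. *)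
Fixpoint ais_sum (F : nat -> A) (n : nat) : A :=
  if n is m.+1 then (ais_sum F m + F m.+1)%AIS else F 0.

Lemma eq_ais_sum (F G : nat -> A) n :
  (forall i, i <= n -> F i = G i) -> ais_sum F n = ais_sum G n.
Proof.
elim: n => [|n IHn] eqFG /=; first exact: eqFG.
by rewrite eqFG // IHn // => i le_in; apply: eqFG; apply: leqW.
Qed.

Lemma ais_sum_cst (a : A) n : ais_sum (fun=> a) n = a.
Proof. by elim: n => //= n ->; apply: ais_addxx. Qed.

(** Both S7 and the cycle semirings are flat: every element but the top one
    satisfies this minimality hypothesis. *)
Lemma ais_sum_minimal (v : A) (F : nat -> A) n :
  (forall x y : A, (x + y)%AIS = v -> x = v /\ y = v) ->
  ais_sum F n = v -> forall i, i <= n -> F i = v.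
Proof.
move=> vmin; elim: n => [|n IHn] /=; first by move=> Fv i; rewrite leqn0 => /eqP ->.
move=> /vmin [sumv Fv] i; rewrite leq_eqVlt ltnS => /predU1P [->//|].
exact: IHn.
Qed.

End NonemptySums.

Lemma ais_sum_hom (A B : aiSemiringType) (f : A -> B) F n :
  ais_hom f -> f (ais_sum F n) = ais_sum (fun i => f (F i)) n.
Proof. by move=> [fD _]; elim: n => //= n IHn; rewrite fD IHn. Qed.

(** Summing over i <= n closes the walk after n + 1 steps. *)
Definition closed_walk (A : aiSemiringType) (n : nat) (x : nat -> A) : A :=
  ais_sum (fun i => x i * x (i.+1 %% n.+1))%AIS n.

Lemma closed_walk_hom (A B : aiSemiringType) (f : A -> B) n x :
  ais_hom f -> f (closed_walk n x) = closed_walk n (fun i => f (x i)).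
Proof.
move=> fh; rewrite /closed_walk ais_sum_hom //.
by apply: eq_ais_sum => i _; case: fh => _ ->.
Qed.

Lemma closed_walk_minimal (A : aiSemiringType) (v : A) n x :
  (forall y z : A, (y + z)%AIS = v -> y = v /\ z = v) ->
  closed_walk n x = v ->
  (forall i, i < n -> (x i * x i.+1)%AIS = v) /\ (x n * x 0)%AIS = v.
Proof.
move=> vmin /(ais_sum_minimal vmin) walk; split=> [i lt_in|].
- by rewrite -(walk i (ltnW lt_in)) modn_small.
- by rewrite -(walk n (leqnn n)) modnn.
Qed.

Definition cycle_identity (n : nat) : ais_class := fun A =>
  forall x : nat -> A, (closed_walk n x * closed_walk n x)%AIS = closed_walk n x.

Lemma cycle_identity_variety n : is_variety (cycle_identity n).
Proof.
split.
- move=> A B f fh fs idA y.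
  have [x xy] : exists x, (fun i => f (x i)) = y.
    exists (fun i => sval (cid (fs (y i)))).
    by apply: functional_extensionality_dep => i; case: (cid _).
  by rewrite -xy -closed_walk_hom // -(proj2 fh) idA.
- move=> A B f fh fi idB x; apply: fi.
  by rewrite (proj2 fh) closed_walk_hom.
- move=> I F idF x; apply: functional_extensionality_dep => i.
  have proj_hom : @ais_hom (ais_prod F) (F i) (fun g => g i) by [].
  rewrite [LHS](proj2 proj_hom) (closed_walk_hom _ _ proj_hom).
  exact: idF.
Qed.

(** The sum takes the value [S7_a] only if the variables alternate between
    [S7_1] and [S7_a]; as n is even, x n is then equal to x 0, and [S7_a] is not
    a square in S7. *)
Lemma S7_cycle_identity n : odd n.+1 -> cycle_identity n S7.
Proof.
move=> odd_n x.
(* 1 and inf are idempotent: only the value a needs an argument. *)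
case ewalk: (closed_walk n x : S7) => //.
have [|step close] := closed_walk_minimal _ ewalk; first by do 2!case.
pose flip (s : S7) := match s with S7_1 => S7_a | S7_a => S7_1 | s => s end.
have mul_a s t : S7_mul s t = S7_a -> t = flip s by case: s; case: t.
have alt i : i <= n -> x i = if odd i then flip (x 0) else x 0.
  elim: i => //= i IHi lt_in; rewrite (mul_a _ _ (step i lt_in)) IHi 1?ltnW //.
  by case: (odd i) => //=; case: (x 0).
move: close; rewrite alt // (negPf (_ : ~~ odd n)) //.
by case: (x 0).
Qed.

Lemma iter_ordS q (u : 'I_q) i : iter i (@ordS q) u = (u + i) %% q :> nat.
Proof.
elim: i => [|i IHi]; first by rewrite addn0 modn_small.
by rewrite iterS /= IHi -[(_ %% _).+1]addn1 modnDml addn1 addnS.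
Qed.

(** If the sum is omega, the variables are consecutive vertices of the q-cycle;
    as the last product brings the walk back to its start after n + 1 steps, q
    divides n + 1. *)
Lemma cycle_cycle_identity q n : ~~ (q %| n.+1) ->
  cycle_identity n (cycle_semiring q).
Proof.
move=> ndvd x; case ewalk: (closed_walk n x : cycle_semiring q) => [v||] //.
(* The value is a vertex, but products never are. *)
- have [|_] := closed_walk_minimal _ ewalk.
    by move=> [a||] [b||] //=; rewrite /ais_add /=; case: eqP => // -> [->].
  by rewrite /ais_mul /=; case: (x n) => [a||]; case: (x 0) => [b||] //=; case: ifP.
- have [|step close] := closed_walk_minimal _ ewalk.
    by move=> [a||] [b||] //=; rewrite /ais_add /=; case: eqP.
  have edge (s t : cycle_semiring q) : (s * t)%AIS = cyc_omega ->
      exists u, s = cyc_vertex u /\ t = cyc_vertex (ordS u).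
    case: s => [a||]; case: t => [b||] //; rewrite /ais_mul /=.
    by case: eqP => // -> _; exists a.
  have [w [xn x0]] := edge _ _ close.
  have walk i : i <= n -> x i = cyc_vertex (iter i (@ordS q) (ordS w)).
    elim: i => [//|i IHi] lt_in; have [u [xi ->]] := edge _ _ (step i lt_in).
    by move: xi; rewrite IHi 1?ltnW // => -[<-].
  have := walk n (leqnn n).
  rewrite xn -iterSr => -[/(congr1 (@nat_of_ord q))]; rewrite -iterS iter_ordS => wE.
  have: w + n.+1 == w + 0 %[mod q] by rewrite -wE addn0 modn_small.
  by rewrite eqn_modDl mod0n -/(q %| n.+1) (negPf ndvd).
Qed.

(** The walk once around the cycle gives omega, whose square is zero. *)
Lemma cycle_not_cycle_identity n : ~ cycle_identity n (cycle_semiring n.+1).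
Proof.
move=> /(_ (fun i => cyc_vertex (inord (i %% n.+1)))).
rewrite /closed_walk (@eq_ais_sum _ _ (fun=> cyc_omega)) ?ais_sum_cst //.
move=> i le_in; rewrite /ais_mul /= modn_mod ifT //.
apply/eqP; apply: val_inj; rewrite /= !inordK ?ltn_pmod //.
by rewrite -[(i %% n.+1).+1]addn1 modnDml addn1.
Qed.

(** * The order embedding *)

Lemma W_le (Q Q' : set nat) : Q `<=` Q' -> class_incl (W_ Q) (W_ Q').
Proof.
move=> sQQ'; apply: generated_variety_min; first exact: generated_variety_is_variety.
move=> A KA; apply: generated_variety_base.
by case: KA => [->|[q Qq ->]]; [left | right; exists q => //; apply: sQQ'].
Qed.

Lemma W_cycle_identity (Q : set nat) n : Q `<=` odd_primes ->
  prime n.+1 -> odd n.+1 -> ~ Q n.+1 -> class_incl (W_ Q) (cycle_identity n).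
Proof.
move=> oddQ pr_p odd_p nQp; apply: generated_variety_min.
  exact: cycle_identity_variety.
move=> A [->|[q Qq ->]]; first exact: S7_cycle_identity.
have [pr_q _] := oddQ q Qq.
apply: cycle_cycle_identity; rewrite dvdn_prime2 //.
by apply/eqP => eqp; apply: nQp; rewrite -eqp.
Qed.

Theorem theorem7p2 :
  (forall Q : set nat, Q `<=` odd_primes ->
     in_interval V_S7 V_M2S7 (W_ Q)) /\
  (forall Q Q' : set nat, Q `<=` odd_primes -> Q' `<=` odd_primes ->
     (Q `<=` Q' <-> class_incl (W_ Q) (W_ Q'))).
Proof.
split=> [Q oddQ|Q Q' oddQ oddQ']; first split.
- exact: generated_variety_is_variety.
- apply: generated_variety_min; first exact: generated_variety_is_variety.
  by move=> A ->; apply: generated_variety_base; left.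
- apply: generated_variety_min; first exact: generated_variety_is_variety.
  move=> A [->|[q /oddQ [/prime_gt0 q_gt0 _] ->]].
  + exact: S7_in_V_M2S7.
  + exact: cycle_in_V_M2S7.
split; first exact: W_le.
move=> incl [/oddQ [] //|n] Qn; have [pr_p odd_p] := oddQ _ Qn.
apply: contrapT => nQ'n; apply: (@cycle_not_cycle_identity n).
apply: (W_cycle_identity oddQ' pr_p odd_p nQ'n); apply: incl.
by apply: generated_variety_base; right; exists n.+1.
Qed.
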